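(* Let $A\in\mathbb{R}^{n\times n}$ be such that $A+A^*$ is positive semidefinite, let $v\in\mathbb{R}^n$ be nonzero, $\beta=\|v\|$, $\gamma>0$, and let $V_{k+1}$, $V_k$, $\tilde H_k$, $\tilde h_{k+1,k}$, $v_{k+1}$ be produced by $k$ steps of the Arnoldi process for the matrix $(I+\gamma A)^{-1}$ and the vector $v$ (as specified in the context). Set $H_k=\frac1\gamma(\tilde H_k^{-1}-I)$ and let $$y_k(t)=V_k\exp(-tH_k)(\beta e_1)$$ be the shift-and-invert Krylov subspace approximation to $y(t)=\exp(-tA)v$. Then for any $t\geq 0$ the residual $r_k(t)=-Ay_k(t)-y_k'(t)$ is $$r_k(t)=\beta\,\frac{\tilde h_{k+1,k}}{\gamma}\,\bigl(e_k^T\tilde H_k^{-1}\exp(-tH_k)e_1\bigr)\,(I+\gamma A)v_{k+1},$$ and $$\|r_k(t)\|\leq \beta\left|\frac{\tilde h_{k+1,k}}{\gamma}\right|\,\bigl|e_k^T\tilde H_k^{-1}\exp(-tH_k)e_1\bigr|\,(1+\gamma\|A\|).$$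
   Context: $\|\cdot\|$ is the Euclidean vector norm or the induced matrix norm. After $k$ steps, the Arnoldi process applied to $(I+\gamma A)^{-1}$ and $v$ delivers orthonormal vectors $v_1,\dots,v_{k+1}\in\mathbb{R}^n$ with $v_1=v/\|v\|$ and an upper-Hessenberg matrix $\underline{\tilde H}_k\in\mathbb{R}^{(k+1)\times k}$ with last row $(0,\dots,0,\tilde h_{k+1,k})$. With $V_j=[v_1,\dots,v_j]\in\mathbb{R}^{n\times j}$ and $\tilde H_k\in\mathbb{R}^{k\times k}$ consisting of the first $k$ rows of $\underline{\tilde H}_k$, one has $(I+\gamma A)^{-1}V_k=V_{k+1}\underline{\tilde H}_k$, equivalently $$(I+\gamma A)^{-1}V_k=V_k\tilde H_k+\tilde h_{k+1,k}v_{k+1}e_k^T .$$ Here $e_1=(1,0,\dots,0)^T\in\mathbb{R}^k$ and $e_k=(0,\dots,0,1)^T\in\mathbb{R}^k$. The residual of a differentiable vector function $y_k(t)$ approximating the solution $y(t)=\exp(-tA)v$ of $y'(t)=-Ay(t)$, $y(0)=v$, is defined as $r_k(t)=-Ay_k(t)-y_k'(t)$. *)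

(* Defs.v *)
From HB Require Import structures.
From mathcomp Require Import all_boot all_order all_algebra.
From mathcomp Require Import all_classical all_reals all_analysis.

Set Implicit Arguments.
Unset Strict Implicit.
Unset Printing Implicit Defensive.

Import Order.TTheory GRing.Theory Num.Theory.
Import numFieldNormedType.Exports.

Local Open Scope classical_set_scope.
Local Open Scope ring_scope.

(* The library norm `|x| on matrices is the max norm, hence the next two
   definitions. *)
Definition enorm (R : realType) (n : nat) (x : 'cV[R]_n) : R :=
  Num.sqrt (\sum_i x i 0 ^+ 2).

Definition opnorm (R : realType) (m n : nat) (A : 'M[R]_(m, n)) : R :=
  sup [set enorm (A *m x) | x in [set x : 'cV[R]_n | enorm x = 1]].

Definition psdmx (R : realType) (n : nat) (B : 'M[R]_n) : Prop :=
  B^T = B /\ forall x : 'cV[R]_n, 0 <= (x^T *m B *m x) 0 0.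

(* The limit is taken in the (finite-dimensional) normed space 'M[R]_n. *)
Definition expmx (R : realType) (n : nat) (B : 'M[R]_n) : 'M[R]_n :=
  limn (series (fun j : nat => (j`!%:R)^-1 *: B ^+ j)).

Definition first_cols (R : realType) (n k : nat) (V : 'M[R]_(n, k.+1)) :
    'M[R]_(n, k) :=
  colsub (widen_ord (leqnSn k)) V.

Definition first_rows (R : realType) (n k : nat) (H : 'M[R]_(k.+1, n)) :
    'M[R]_(k, n) :=
  rowsub (widen_ord (leqnSn k)) H.

(* V and H are delivered by k.+1 steps of the Arnoldi process for B and v:
   the columns of V are v_1, ..., v_{k+2}, and H is the (k+2) x (k+1)
   upper-Hessenberg matrix. The number of steps is written as a successor since
   at least one step is performed. *)
Definition arnoldi (R : realType) (n k : nat) (B : 'M[R]_n) (v : 'cV[R]_n)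
    (V : 'M[R]_(n, k.+2)) (H : 'M[R]_(k.+2, k.+1)) : Prop :=
  [/\ V^T *m V = 1%:M,
      col ord0 V = (enorm v)^-1 *: v,
      forall (i : 'I_k.+2) (j : 'I_k.+1), (j.+1 < i)%N -> H i j = 0
    & B *m first_cols V = V *m H].

Definition residual (R : realType) (n : nat) (A : 'M[R]_n) (y : R -> 'cV[R]_n)
    (t : R) : 'cV[R]_n :=
  - (A *m y t) - derive1 y t.

(* Main.v *)
(* Write M = I + gamma A. As A + A^T is positive semidefinite,
   |x|^2 <= x^T M x, so M is invertible, and so is tH = Vk^T M^-1 Vk, since
   tH x = 0 gives w^T M w = 0 for w = M^-1 Vk x. Multiplying the Arnoldi
   recurrence by M on the left and by tH^-1 on the right gives
     - A Vk + Vk H = (h / gamma) M v_{k+1} ek^T tH^-1,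
   and applying this to exp(-t H) (beta e1) gives the residual. The norm bound
   follows from |v_{k+1}| = 1. The derivative of the exponential is taken
   entrywise: each entry of P exp(t B) Q is a scalar power series whose formal
   derivative is the series of the same entry for P B instead of P. *)
Require Import Defs.
From HB Require Import structures.
From mathcomp Require Import all_boot all_order all_algebra.
From mathcomp Require Import ring.
From mathcomp Require Import all_classical all_reals all_analysis.

Set Implicit Arguments.
Unset Strict Implicit.
Unset Printing Implicit Defensive.

Import Order.TTheory GRing.Theory Num.Theory.
Import numFieldNormedType.Exports.

Local Open Scope classical_set_scope.
Local Open Scope ring_scope.

(** * Convergence and derivative of the matrix exponential *)

Lemma cvg_mx (R : realFieldType) (m n : nat) (T : Type) (F : set_system T)
    (FF : Filter F) (u : T -> 'M[R]_(m, n)) (l : 'M[R]_(m, n)) :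
  (forall i j, u x i j @[x --> F] --> l i j) -> u @ F --> l.
Proof.
move=> ul; apply/cvgrPdist_le => /= e e0; near=> x.
rewrite /Num.Def.normr/= mx_normrE (bigmax_le _ (ltW e0))//= => i _.
(* There are finitely many indices, so the entrywise neighbourhoods can be intersected. *)
rewrite !mxE/=; move: i; near: x; apply: filter_forall => /= i.
exact: ((cvgrPdist_le _ _).1 (ul i.1 i.2)).
Unshelve. all: by end_near. Qed.

Lemma mulmx_entryE (R : pzRingType) (m n p q : nat) (P : 'M[R]_(m, n))
    (M : 'M[R]_(n, p)) (Q : 'M[R]_(p, q)) i j :
  (P *m M *m Q) i j = \sum_b (\sum_a P i a * M a b) * Q b j.
Proof. by rewrite mxE; apply: eq_bigr => b _; rewrite mxE. Qed.

(** The sum of all absolute entries dominates each row sum of [B], so every further factor [B] costs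
    at most one such factor. *)
Lemma normr_expmx_entry (R : realType) (n : nat) (B : 'M[R]_n) (l : nat) i j :
  `|(B ^+ l) i j| <= (\sum_a \sum_b `|B a b|) ^+ l.
Proof.
elim: l i => [|l IH] i.
  by rewrite !expr0 mxE; case: (i == j); rewrite ?normr1 ?normr0.
rewrite exprS mxE exprS (le_trans (ler_norm_sum _ _ _))//.
apply: (@le_trans _ _ ((\sum_b `|B i b|) * (\sum_a \sum_b `|B a b|) ^+ l)).
  by rewrite mulr_suml ler_sum// => b _; rewrite normrM ler_wpM2l.
rewrite ler_wpM2r ?exprn_ge0//.
  by rewrite sumr_ge0// => a _; rewrite sumr_ge0.
rewrite [leRHS](bigD1 i)//= lerDl sumr_ge0// => a _.
by rewrite sumr_ge0.
Qed.

(** Comparison with the scalar exponential series at [c * |x|], where [c] is the sum of the absolute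
    entries of [B]. *)
Lemma is_cvg_expmx_entry (R : realType) (n : nat) (B : 'M[R]_n) i j (x : R) :
  cvgn (pseries (fun l => (l`!%:R)^-1 * (B ^+ l) i j) x).
Proof.
set c := \sum_a \sum_b `|B a b|.
have c0 : 0 <= c by rewrite sumr_ge0// => a _; rewrite sumr_ge0.
apply: normed_cvg.
apply: (series_le_cvg _ _ _ (is_cvg_series_exp_coeff (c * `|x|))) => //= l.
  by rewrite /exp_coeff/= divr_ge0// exprn_ge0// mulr_ge0.
rewrite /exp_coeff/= !normrM normrX exprMn ger0_norm ?invr_ge0//.
rewrite -mulrA mulrC ler_wpM2r ?invr_ge0// ler_wpM2r ?exprn_ge0//.
exact: normr_expmx_entry.
Qed.

(** [limn] has a meaning only for a convergent sequence; this makes [expmx] a genuine limit. *)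
Lemma cvg_expmx (R : realType) (n : nat) (B : 'M[R]_n) :
  series (fun j : nat => (j`!%:R)^-1 *: B ^+ j) @ \oo --> expmx B.
Proof.
apply: cvgP.
apply: (@cvg_mx _ _ _ _ _ _ _
  (\matrix_(i, j) limn (pseries (fun l => (l`!%:R)^-1 * (B ^+ l) i j) 1))).
move=> i j; rewrite mxE.
suff -> : (fun N => series (fun j : nat => (j`!%:R)^-1 *: B ^+ j) N i j) =
    pseries (fun l => (l`!%:R)^-1 * (B ^+ l) i j) 1 by exact: is_cvg_expmx_entry.
apply/funext => N; rewrite /pseries /series/= summxE.
by apply: eq_bigr => l _; rewrite mxE expr1n mulr1.
Qed.

Lemma exprZ_mx (R : comPzRingType) (n : nat) (x : R) (B : 'M[R]_n) (l : nat) :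
  (x *: B) ^+ l = x ^+ l *: B ^+ l.
Proof.
elim: l => [|l IH]; first by rewrite !expr0 scale1r.
by rewrite !exprS IH -[LHS]/(_ *m _) -scalemxAl -scalemxAr scalerA.
Qed.

(** An entry of the product is a finite sum of multiples of entries of the exponential, so limits
    pass through it. The outer factors let one scalar power series serve for the derivative. *)
Lemma cvg_expmx_sandwich (R : realType) (m n p : nat) (P : 'M[R]_(m, n))
    (B : 'M[R]_n) (Q : 'M[R]_(n, p)) i j (x : R) :
  pseries (fun l => (l`!%:R)^-1 * (P *m B ^+ l *m Q) i j) x @ \oo -->
    (P *m expmx (x *: B) *m Q) i j.
Proof.
rewrite mulmx_entryE.
set S := series (fun j : nat => (j`!%:R)^-1 *: (x *: B) ^+ j).
rewrite (_ : pseries _ _ = fun N => (P *m S N *m Q) i j); last first.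
  apply/funext => N; rewrite /S /pseries /series/= mulmx_sumr mulmx_suml summxE.
  apply: eq_bigr => l _.
  by rewrite exprZ_mx -!scalemxAr -!scalemxAl !mxE mulrCA mulrC mulrA.
under eq_fun do rewrite mulmx_entryE.
apply: (cvg_big add_continuous) => b _; apply: cvgM; last exact: cvg_cst.
apply: (cvg_big add_continuous) => a _; apply: cvgM; first exact: cvg_cst.
exact: (continuous_cvg _ (@coord_continuous _ _ _ a b _) (@cvg_expmx _ _ _)).
Qed.

Lemma is_derive_expmx (R : realType) (m n p : nat) (P : 'M[R]_(m, n))
    (B : 'M[R]_n) (Q : 'M[R]_(n, p)) (t : R) :
  is_derive t (1 : R) (fun x => P *m expmx (x *: B) *m Q)
    (P *m B *m expmx (t *: B) *m Q).
Proof.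
(* The factor [l.+1] cancels against [l.+1]!, and the extra [B] is absorbed into the left factor, so
   the statement can be iterated. *)
have diffsE (P' : 'M[R]_(m, n)) i j :
    pseries_diffs (fun l => (l`!%:R)^-1 * (P' *m B ^+ l *m Q) i j) =
    fun l => (l`!%:R)^-1 * (P' *m B *m B ^+ l *m Q) i j.
  apply/funext => l; rewrite /pseries_diffs factS natrM invfM mulrA mulVKf//.
  by rewrite exprS -[P' *m B *m _]mulmxA.
have entry i j : is_derive t (1 : R) (fun x => (P *m expmx (x *: B) *m Q) i j)
    ((P *m B *m expmx (t *: B) *m Q) i j).
  have limE (P' : 'M[R]_(m, n)) x : (P' *m expmx (x *: B) *m Q) i j =
      limn (pseries (fun l => (l`!%:R)^-1 * (P' *m B ^+ l *m Q) i j) x).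
    exact/esym/cvg_lim/cvg_expmx_sandwich.
  under eq_fun do rewrite limE.
  (* Termwise differentiation requires convergence of the series and of its first two formal
     derivatives at a point of modulus above [|t|]. *)
  rewrite limE -diffsE; apply: (@pseries_snd_diffs _ _ (`|t| + 1)).
  - exact/cvgP/cvg_expmx_sandwich.
  - by rewrite diffsE; exact/cvgP/cvg_expmx_sandwich.
  - by rewrite !diffsE; exact/cvgP/cvg_expmx_sandwich.
  - by rewrite [ltRHS]ger0_norm// ltrDl.
have dv : derivable (fun x : R => P *m expmx (x *: B) *m Q) t 1.
  by apply/derivable_mxP => i j; have [] := entry i j.
apply: DeriveDef => //; rewrite derive_mx//.
by apply/matrixP => i j; rewrite mxE; have [_ ->] := entry i j.
Qed.

(** * The Euclidean norm and its induced operator norm *)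

Lemma enorm_ge0 (R : realType) (n : nat) (x : 'cV[R]_n) : 0 <= enorm x.
Proof. exact: sqrtr_ge0. Qed.

Lemma sqr_enorm (R : realType) (n : nat) (x : 'cV[R]_n) :
  enorm x ^+ 2 = \sum_i x i 0 ^+ 2.
Proof. by rewrite sqr_sqrtr// sumr_ge0// => i _; rewrite sqr_ge0. Qed.

Lemma sqr_enorm_le0 (R : realType) (n : nat) (x : 'cV[R]_n) :
  enorm x ^+ 2 <= 0 -> x = 0.
Proof.
rewrite sqr_enorm => x0; apply/matrixP => i j; rewrite ord1 mxE; apply/eqP.
rewrite -sqrf_eq0; apply/eqP/le_anti; rewrite sqr_ge0 andbT.
by apply: le_trans x0; rewrite (bigD1 i)//= lerDl sumr_ge0// => k _; rewrite sqr_ge0.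
Qed.

Lemma enormZ (R : realType) (n : nat) (a : R) (x : 'cV[R]_n) :
  enorm (a *: x) = `|a| * enorm x.
Proof.
rewrite /enorm -sqrtr_sqr -sqrtrM ?sqr_ge0// mulr_sumr; congr Num.sqrt.
by apply: eq_bigr => i _; rewrite mxE exprMn.
Qed.

(** The squares of [b * f i - c * g i] sum to [b * (a * b - c ^+ 2)]. A positive [b] can be divided
    out; if [b = 0], every [g i] vanishes. *)
Lemma cauchy_schwarz_sum (R : realType) (I : finType) (f g : I -> R) :
  (\sum_i f i * g i) ^+ 2 <= (\sum_i f i ^+ 2) * (\sum_i g i ^+ 2).
Proof.
set a := \sum_i f i ^+ 2; set b := \sum_i g i ^+ 2; set c := \sum_i f i * g i.
have b0 : 0 <= b by rewrite sumr_ge0// => i _; rewrite sqr_ge0.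
have key : 0 <= b * (a * b - c ^+ 2).
  suff <- : \sum_i (b * f i - c * g i) ^+ 2 = b * (a * b - c ^+ 2).
    by rewrite sumr_ge0// => i _; rewrite sqr_ge0.
  rewrite (eq_bigr (fun i => b ^+ 2 * f i ^+ 2 - 2 * b * c * (f i * g i)
                             + c ^+ 2 * g i ^+ 2)); last by move=> i _; ring.
  rewrite big_split/= sumrB -!mulr_sumr -/a -/b -/c; ring.
move: b0; rewrite le_eqVlt => /predU1P[b0|b0]; last first.
  by rewrite -subr_ge0; rewrite pmulr_rge0 in key.
have g0 i : g i = 0.
  apply/eqP; rewrite -sqrf_eq0; apply/eqP/le_anti; rewrite sqr_ge0 andbT b0.
  by rewrite /b (bigD1 i)//= lerDl sumr_ge0// => k _; rewrite sqr_ge0.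
by rewrite -b0 mulr0 /c big1 ?expr0n// => i _; rewrite g0 mulr0.
Qed.

Lemma ler_enormD (R : realType) (n : nat) (x y : 'cV[R]_n) :
  enorm (x + y) <= enorm x + enorm y.
Proof.
have xy : \sum_i x i 0 * y i 0 <= enorm x * enorm y.
  apply: le_trans (ler_norm _) _; rewrite -sqrtr_sqr.
  rewrite /enorm -sqrtrM; last by rewrite sumr_ge0// => i _; rewrite sqr_ge0.
  by apply: ler_wsqrtr; exact: cauchy_schwarz_sum.
rewrite -(@ler_pXn2r _ 2)// ?nnegrE ?addr_ge0 ?enorm_ge0//.
rewrite sqrrD !sqr_enorm.
apply: (@le_trans _ _ (\sum_i x i 0 ^+ 2 + (\sum_i x i 0 * y i 0) *+ 2
                        + \sum_i y i 0 ^+ 2)).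
  rewrite -sumrMnl -!big_split/=; apply: ler_sum => i _.
  by rewrite mxE sqrrD.
by rewrite lerD2r lerD2l lerMn2r.
Qed.

Lemma enorm_mulmx_le_opnorm (R : realType) (m n : nat) (A : 'M[R]_(m, n))
    (x : 'cV[R]_n) :
  enorm x = 1 -> enorm (A *m x) <= opnorm A.
Proof.
move=> x1; apply: ub_le_sup; last by exists x.
(* The Frobenius norm bounds the set, by Cauchy-Schwarz on each row, so its supremum is an upper
   bound. *)
exists (Num.sqrt (\sum_i \sum_j A i j ^+ 2)) => _ [z /= z1 <-].
apply: ler_wsqrtr; apply: ler_sum => i _; rewrite mxE.
apply: le_trans (cauchy_schwarz_sum _ _) _.
by rewrite -sqr_enorm z1 expr1n mulr1.
Qed.

(** * Invertibility and positivity of the shifted form *)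

Lemma inj_mulmx_unitmx (F : fieldType) (n : nat) (M : 'M[F]_n) :
  (forall x : 'cV[F]_n, M *m x = 0 -> x = 0) -> M \in unitmx.
Proof.
(* [inj_row_free] concerns row vectors, hence the transpose. *)
move=> Minj; rewrite -unitmx_tr -row_free_unit; apply: inj_row_free => w wM.
by apply: trmx_inj; rewrite trmx0; apply: Minj; rewrite -[M]trmxK -trmx_mul wM trmx0.
Qed.

(** A scalar equals its transpose, so [A] and [A^T] have the same quadratic form, which is half that
    of [A + A^T]. *)
Lemma sqr_enorm_le_shift (R : realType) (n : nat) (A : 'M[R]_n) (gamma : R)
    (x : 'cV[R]_n) : psdmx (A + A^T) -> 0 <= gamma ->
  enorm x ^+ 2 <= (x^T *m (1%:M + gamma *: A) *m x) 0 0.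
Proof.
move=> [_ /(_ x)] + gamma0.
have -> : (x^T *m (A + A^T) *m x) 0 0 = (x^T *m A *m x) 0 0 *+ 2.
  rewrite mulmxDr mulmxDl mxE mulr2n; congr (_ + _).
  have -> : x^T *m A^T *m x = (x^T *m A *m x)^T.
    by rewrite !trmx_mul trmxK mulmxA.
  by rewrite mxE.
rewrite pmulrn_lge0// => Ax.
have -> : enorm x ^+ 2 = (x^T *m x) 0 0.
  by rewrite sqr_enorm mxE; apply: eq_bigr => i _; rewrite mxE expr2.
rewrite mulmxDr mulmxDl mulmx1 -scalemxAr -scalemxAl [leRHS]mxE lerDl mxE.
exact: mulr_ge0.
Qed.

(** * Consequences of the Arnoldi relation *)

Lemma arnoldi_ortho (R : realType) (n k : nat) (B : 'M[R]_n) (v : 'cV[R]_n)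
    (V : 'M[R]_(n, k.+2)) (uH : 'M[R]_(k.+2, k.+1)) :
  arnoldi B v V uH ->
  (first_cols V)^T *m first_cols V = 1%:M.
Proof.
move=> [VV _ _ _]; apply/matrixP => i j.
have := congr1 (fun M : 'M[R]_(k.+2) =>
  M (widen_ord (leqnSn _) i) (widen_ord (leqnSn _) j)) VV.
rewrite !mxE -val_eqE/= => <-.
by apply: eq_bigr => a _; rewrite !mxE.
Qed.

Lemma arnoldi_last_ortho (R : realType) (n k : nat) (B : 'M[R]_n) (v : 'cV[R]_n)
    (V : 'M[R]_(n, k.+2)) (uH : 'M[R]_(k.+2, k.+1)) :
  arnoldi B v V uH ->
  (first_cols V)^T *m col ord_max V = 0.
Proof.
move=> [VV _ _ _]; apply/matrixP => i j.
have := congr1 (fun M : 'M[R]_(k.+2) => M (widen_ord (leqnSn _) i) ord_max) VV.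
rewrite !mxE -val_eqE/= ltn_eqF//= mulr0n => VV0; rewrite -[RHS]VV0.
by apply: eq_bigr => a _; rewrite !mxE.
Qed.

Lemma arnoldi_last_enorm (R : realType) (n k : nat) (B : 'M[R]_n) (v : 'cV[R]_n)
    (V : 'M[R]_(n, k.+2)) (uH : 'M[R]_(k.+2, k.+1)) :
  arnoldi B v V uH ->
  enorm (col ord_max V) = 1.
Proof.
move=> [VV _ _ _].
have := congr1 (fun M : 'M[R]_(k.+2) => M ord_max ord_max) VV.
rewrite !mxE eqxx mulr1n /enorm => VV1; rewrite -[RHS]sqrtr1 -VV1; congr Num.sqrt.
by apply: eq_bigr => a _; rewrite !mxE expr2.
Qed.

Lemma arnoldi_recurrence (R : realType) (n k : nat) (B : 'M[R]_n) (v : 'cV[R]_n)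
    (V : 'M[R]_(n, k.+2)) (uH : 'M[R]_(k.+2, k.+1)) :
  arnoldi B v V uH ->
  B *m first_cols V = first_cols V *m first_rows uH +
    uH ord_max ord_max *: (col ord_max V *m (delta_mx ord_max 0)^T).
Proof.
move=> [_ _ hess ->]; apply/matrixP => i j.
rewrite !mxE big_ord_recr/=; congr (_ + _).
  by apply: eq_bigr => a _; rewrite !mxE.
rewrite big_ord1 !mxE eqxx andbT; case: (eqVneq j ord_max) => [->|jk].
  by rewrite mulr1 mulrC.
(* For [j] other than the last column, the last row lies strictly below the subdiagonal. *)
rewrite mulr0 mulr0 hess ?mulr0//= ltnS ltn_neqAle -ltnS ltn_ord andbT.
by rewrite -val_eqE in jk.
Qed.

(** The last basis vector is orthogonal to the others, so projecting the recurrence removes the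
    rank-one term. *)
Lemma arnoldi_project (R : realType) (n k : nat) (B : 'M[R]_n) (v : 'cV[R]_n)
    (V : 'M[R]_(n, k.+2)) (uH : 'M[R]_(k.+2, k.+1)) :
  arnoldi B v V uH ->
  (first_cols V)^T *m B *m first_cols V = first_rows uH.
Proof.
move=> hV; rewrite -mulmxA (arnoldi_recurrence hV) mulmxDr mulmxA.
rewrite (arnoldi_ortho hV) mul1mx.
by rewrite -scalemxAr mulmxA (arnoldi_last_ortho hV) mul0mx scaler0 addr0.
Qed.

(** * The residual identity and its norm bound *)

Theorem lemma2p2 (R : realType) (n k : nat) (A : 'M[R]_n) (v : 'cV[R]_n)
    (gamma : R) (V : 'M[R]_(n, k.+2)) (uH : 'M[R]_(k.+2, k.+1))
    (hA : psdmx (A + A^T)) (hv : v != 0) (hgamma : 0 < gamma)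
    (hV : arnoldi (invmx (1%:M + gamma *: A)) v V uH) :
  let beta := enorm v in
  let Vk := first_cols V in
  let vlast := col ord_max V in
  let tH := first_rows uH in
  let h := uH ord_max ord_max in
  let H := gamma^-1 *: (invmx tH - 1%:M) in
  let e1 : 'cV[R]_k.+1 := delta_mx ord0 0 in
  let ek : 'cV[R]_k.+1 := delta_mx ord_max 0 in
  let y := fun t : R => Vk *m expmx (- t *: H) *m (beta *: e1) in
  let s := fun t : R => (ek^T *m invmx tH *m expmx (- t *: H) *m e1) 0 0 in
  [/\ 1%:M + gamma *: A \in unitmx,
      tH \in unitmx
    & forall t : R, 0 <= t ->
      [/\ derivable y t 1,
          residual A y t =
            (beta * (h / gamma) * s t) *: ((1%:M + gamma *: A) *m vlast)
        & enorm (residual A y t) <=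
            beta * `|h / gamma| * `|s t| * (1 + gamma * opnorm A)]].
Proof.
move=> beta Vk vlast tH h H e1 ek y s.
set M := 1%:M + gamma *: A.
have form x : enorm x ^+ 2 <= (x^T *m M *m x) 0 0.
  by apply: sqr_enorm_le_shift => //; exact: ltW.
have uM : M \in unitmx.
  apply: inj_mulmx_unitmx => x Mx; apply: sqr_enorm_le0; apply: le_trans (form x) _.
  by rewrite -mulmxA Mx mulmx0 mxE.
have utH : tH \in unitmx.
  apply: inj_mulmx_unitmx => x.
  rewrite /tH -(arnoldi_project hV) -/M -/Vk => Hx.
  set w := invmx M *m Vk *m x.
  have Mw : M *m w = Vk *m x by rewrite /w -mulmxA mulKVmx.
  (* If [w = 0] then [Vk *m x = M *m w = 0], and orthonormality gives [x = 0]. *)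
  suff w0 : w = 0.
    by rewrite -[x]mul1mx -(arnoldi_ortho hV) -mulmxA -Mw w0 !mulmx0.
  apply: sqr_enorm_le0; apply: le_trans (form w) _.
  have Vw : Vk^T *m w = 0 by rewrite /w !mulmxA.
  rewrite -mulmxA Mw (_ : w^T *m (Vk *m x) = (Vk^T *m w)^T *m x).
    by rewrite Vw trmx0 mul0mx mxE.
  by rewrite [(_ *m w)^T]trmx_mul trmxK mulmxA.
have AVk : - (A *m Vk) + Vk *m H =
    (h / gamma) *: (M *m vlast *m ek^T *m invmx tH).
  have : M *m (invmx M *m Vk) *m invmx tH =
      M *m (Vk *m tH + h *: (vlast *m ek^T)) *m invmx tH.
    by rewrite (arnoldi_recurrence hV).
  rewrite mulKVmx// mulmxDr mulmxDl -scalemxAr -scalemxAl !mulmxA mulmxK// => VtH.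
  (* By [VtH], [Vk *m H] contains [M *m Vk - Vk], that is [gamma *: (A *m Vk)]; division by [gamma]
     makes it cancel [- (A *m Vk)]. *)
  rewrite /H -scalemxAr mulmxBr mulmx1 VtH {1}/M mulmxDl mul1mx -scalemxAl.
  rewrite addrAC [Vk + _]addrC addrK scalerDr !scalerA mulVf ?gt_eqF// scale1r.
  by rewrite addKr mulrC.
split=> // t _.
(* Putting [- H] to the left of the exponential, next to [Vk], makes [AVk] applicable. *)
have dy : is_derive t (1 : R) y (Vk *m (- H) *m expmx (t *: - H) *m (beta *: e1)).
  rewrite /y; under eq_fun do rewrite scaleNr -scalerN; exact: is_derive_expmx.
have resE : residual A y t = (beta * (h / gamma) * s t) *: (M *m vlast).
  rewrite /residual derive1E derive_val /y scaleNr -scalerN.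
  rewrite mulmxN !mulNmx opprK !mulmxA -2!mulNmx -!mulmxDl AVk.
  (* This product is a 1 x 1 matrix, so it can be pulled out as the scalar [s t]. *)
  have sE : ek^T *m (invmx tH *m (expmx (t *: - H) *m e1)) = (s t)%:M.
    by rewrite !mulmxA /s scaleNr -scalerN; exact: mx11_scalar.
  rewrite -!scalemxAl -scalemxAr scalerA -!mulmxA sE mul_mx_scalar -scalemxAr.
  by rewrite scalerA; congr (_ *: _); ring.
split => //.
rewrite resE enormZ !normrM (ger0_norm (enorm_ge0 v)) -/beta ler_wpM2l//.
  by rewrite !mulr_ge0// enorm_ge0.
rewrite mulmxDl mul1mx -scalemxAl; apply: le_trans (ler_enormD _ _) _.
(* As a unit vector, [vlast] belongs to the set over which [opnorm A] is the supremum. *)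
have v1 := arnoldi_last_enorm hV.
rewrite enormZ v1 lerD2l gtr0_norm// ler_wpM2l//; first exact: ltW.
exact: enorm_mulmx_le_opnorm.
Qed.
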